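(* Let $n\ge 6$. Then the set $\{\eta(\Gamma(G)) : \Gamma(G) \text{ an unbalanced signed graph with } G\in \Theta_n\}$ equals $\{0,1,2,\ldots,n-4\}$.
   Context: A signed graph $\Gamma(G)=(G,\sigma)$ consists of a simple graph $G$ and a map $\sigma:E(G)\to\{+,-\}$; its adjacency matrix has entry $\sigma(v_iv_j)$ for edges and $0$ otherwise, and $\eta(\Gamma(G))$ is the multiplicity of $0$ as an eigenvalue. A cycle is positive if it has an even number of negative edges; $\Gamma(G)$ is balanced if all its cycles are positive, and unbalanced otherwise. A bicyclic graph is a connected simple graph with $|E|=|V|+1$. The graph $\Theta(p,q,l)$ is the union of three internally disjoint paths of lengths $p,q,l$ with common end vertices, where $p,q,l\ge1$ and at most one of them equals $1$. $\Theta_n$ is the set of bicyclic graphs on $n$ vertices obtained from some $\Theta(p,q,l)$ by (possibly) attaching trees to some of its vertices. *)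

(* Defs.v *)
From mathcomp Require Import all_boot all_order all_algebra.

Set Implicit Arguments.
Unset Strict Implicit.
Unset Printing Implicit Defensive.

Import GRing.Theory.
Local Open Scope ring_scope.

Record sgraph (V : finType) := SGraph {
  adj :> rel V;
  adj_sym : symmetric adj;
  adj_irr : irreflexive adj
}.

(* [neg e] means that the edge [e] carries the sign [-]; its values on pairs
   that are not edges are never used. *)
Record signed_graph (V : finType) := SignedGraph {
  underlying :> sgraph V;
  neg : {set V} -> bool
}.

Section Graphs.
Variable V : finType.
Implicit Types (G : sgraph V) (Gam : signed_graph V) (S : {set V}).

Definition edges G : {set {set V}} :=
  [set e : {set V} | [exists x, exists y, G x y && (e == [set x; y])]].

(* Connectedness and acyclicity of the induced subgraph G[S]. *)
Definition connected_on G S : Prop :=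
  forall x y, x \in S -> y \in S ->
    connect [rel a b | [&& a \in S, b \in S & G a b]] x y.

Definition is_cycle G (c : seq V) : Prop := (2 < size c)%N /\ ucycle G c.

Definition acyclic_on G S : Prop :=
  forall c : seq V, {subset c <= S} -> ~ is_cycle G c.

Definition is_tree_on G S : Prop :=
  [/\ S != set0, connected_on G S & acyclic_on G S].

Definition bicyclic G : Prop :=
  connected_on G [set: V] /\ #|edges G| = #|V|.+1.

Definition positive_cycle Gam (c : seq V) : Prop :=
  ~~ odd (count (fun x => neg Gam [set x; next c x]) c).

Definition balanced Gam : Prop :=
  forall c, is_cycle Gam c -> positive_cycle Gam c.

Definition unbalanced Gam : Prop := ~ balanced Gam.

(* Edges of the path visiting [x :: s] in this order. *)
Definition path_edges (x : V) (s : seq V) : seq {set V} :=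
  pairmap (fun a b => [set a; b]) x s.

(* G[S] is a Theta(p,q,l): [u] and [v] are the common ends, and [s1], [s2], [s3]
   list the interior vertices of the three paths. *)
Definition is_theta_on (p q l : nat) G S : Prop :=
  exists (u v : V) (s1 s2 s3 : seq V),
    [/\ uniq [:: u, v & s1 ++ s2 ++ s3],
        [/\ size (rcons s1 v) = p, size (rcons s2 v) = q
          & size (rcons s3 v) = l],
        S =i [:: u, v & s1 ++ s2 ++ s3]
      & [set e in edges G | e \subset S] =i
          path_edges u (rcons s1 v) ++ path_edges u (rcons s2 v)
            ++ path_edges u (rcons s3 v)].

Definition theta_lengths (p q l : nat) : Prop :=
  [/\ (0 < p)%N, (0 < q)%N, (0 < l)%N
    & (count_mem 1%N [:: p; q; l] <= 1)%N].

(* G arises from G[S] by attaching to each s in S a tree, namely the one induced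
   on the fibre of [r] over s (reduced to s when nothing is attached there). *)
Definition attached_trees G S : Prop :=
  exists r : V -> V,
    [/\ forall x, r x \in S,
        forall s, s \in S -> r s = s,
        forall s, s \in S -> is_tree_on G [set x | r x == s]
      & forall x y, G x y -> r x = r y \/ (x \in S /\ y \in S)].

Definition in_Theta G : Prop :=
  bicyclic G /\
  exists (p q l : nat) (S : {set V}),
    [/\ theta_lengths p q l, is_theta_on p q l G S & attached_trees G S].

End Graphs.

Definition adj_mx (R : rcfType) (n : nat) (Gam : signed_graph 'I_n) : 'M[R]_n :=
  \matrix_(i, j) if Gam i j then (-1) ^+ neg Gam [set i; j] else 0.

Definition nullity (R : rcfType) (n : nat) (Gam : signed_graph 'I_n) : nat :=
  mup 0 (char_poly (adj_mx R Gam)).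

(* Main.v *)
(* For a real symmetric matrix the nullity is n minus the rank.

   Upper bound: rank >= 4 for every bicyclic graph with n >= 6. If some vertex y
   is adjacent to neither end of an edge xz, then x, z, y and a neighbour of y
   span a nonsingular submatrix, whatever the signs. Otherwise non-adjacency is
   transitive and the graph is complete multipartite, which is incompatible with
   n + 1 edges.

   Realisation of a rank m between 4 and n: the path 0 - 1 - ... - (m-2), with
   n - m + 1 leaves attached to its last vertex (n - 4 when m = 4), and the
   chords 02 and 13, of which only 02 is negative. Deleting n - m leaves gives a
   nonsingular graph on m vertices, and the deleted rows depend on the others. *)
Require Import Defs.
From mathcomp Require Import all_boot all_order all_algebra.
From mathcomp Require Import zify ring lra.

Set Implicit Arguments.
Unset Strict Implicit.
Unset Printing Implicit Defensive.

Import Order.TTheory GRing.Theory Num.Theory.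
Local Open Scope ring_scope.

(** * Nullity of a symmetric matrix as its corank *)

(* Both sides are the determinant of the block matrix [[X, C], [B, 1]] times X^r. *)
Lemma char_poly_mulmx_comm (K : comNzRingType) (n r : nat)
    (C : 'M[K]_(n, r)) (B : 'M[K]_(r, n)) :
  'X^r * char_poly (C *m B) = 'X^n * char_poly (B *m C).
Proof.
pose Cp := map_mx (@polyC K) C; pose Bp := map_mx (@polyC K) B.
pose M : 'M[{poly K}]_(n + r) := block_mx 'X%:M Cp Bp 1%:M.
have detM : \det M = char_poly (C *m B).
  pose L : 'M[{poly K}]_(n + r) := block_mx 1%:M 0 (- Bp) 1%:M.
  have detL : \det L = 1 by rewrite det_lblock !det1 mulr1.
  rewrite -[LHS]mulr1 -detL -det_mulmx mulmx_block.
  rewrite !mulmx1 !mul1mx !mulmx0 !add0r subrr mulmxN det_ublock det1 mulr1.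
  by rewrite /char_poly /char_poly_mx map_mxM.
pose L : 'M[{poly K}]_(n + r) := block_mx 1%:M 0 (- Bp) 'X%:M.
have detL : \det L = 'X^r by rewrite det_lblock det1 det_scalar mul1r.
rewrite -detM -{1}detL -det_mulmx mulmx_block.
rewrite !mulmx1 !mul1mx !mul0mx !addr0 !mulNmx mul_mx_scalar mul_scalar_mx.
rewrite addNr det_ublock det_scalar addrC.
by rewrite /char_poly /char_poly_mx map_mxM.
Qed.

Lemma sum_sqr_eq0 (K : realDomainType) (n : nat) (v : 'rV[K]_n) :
  v *m v^T = 0 -> v = 0.
Proof.
move=> /matrixP /(_ 0 0); rewrite !mxE => /eqP.
rewrite psumr_eq0 => [/allP v0|j _]; last by rewrite mxE -expr2 sqr_ge0.
apply/rowP => j; have := v0 j (mem_index_enum _).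
by rewrite !mxE /= mulf_eq0 orbb => /eqP.
Qed.

(** For a rank factorization [A = C *m B] with [r] the rank, symmetry makes the [r] by [r] matrix
    [B *m C] invertible. So 0 is no root of its characteristic polynomial, and comparing
    multiplicities in [char_poly_mulmx_comm] gives [r + mup = n]. *)
Lemma mup0_char_poly_sym (K : realFieldType) (n : nat) (A : 'M[K]_n) :
  A^T = A -> mup 0 (char_poly A) = (n - \rank A)%N.
Proof.
move=> symA; pose C := col_base A; pose B := row_base A.
have AE : C *m B = A by exact: mulmx_base.
have BC_free : row_free (B *m C).
  apply: inj_row_free => u uBC0; set v := u *m B.
  have vA0 : v *m A = 0 by rewrite -AE mulmxA -(mulmxA u) uBC0 mul0mx.
  have /submxP [w vE] : (v <= A)%MS.
    by apply: submx_trans (submxMl _ _) _; rewrite eq_row_base.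
  (* Writing [v = w *m A], symmetry gives [v *m v^T = v *m A *m w^T = 0]. *)
  have v0 : v = 0.
    apply: sum_sqr_eq0; rewrite {1}vE -mulmxA -{1}symA -trmx_mul vA0.
    by rewrite trmx0 mulmx0.
  by apply: (row_free_inj (row_base_free A)); rewrite mul0mx.
have BC0 : ~~ root (char_poly (B *m C)) 0.
  rewrite rootE horner_coef0 char_poly_det mulf_eq0 signr_eq0 /=.
  by rewrite -unitfE -unitmxE -row_free_unit.
have := char_poly_mulmx_comm C B; rewrite AE => /(congr1 (mup 0)).
have X_neq0 k : 'X^k != 0 :> {poly K} by rewrite -size_poly_eq0 size_polyXn.
have chi_neq0 k (D : 'M[K]_k) : char_poly D != 0.
  exact: monic_neq0 (char_poly_monic _).
rewrite !mupM // (mupNroot BC0) addn0 -['X]subr0 !mup_XsubCX eqxx => rkD.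
by rewrite -[LHS](addKn (\rank A)) rkD.
Qed.

(** * Signed adjacency matrices and the rank bound 4 *)

Section SignedAdjacency.
Variables (R : rcfType) (n : nat) (Gam : signed_graph 'I_n).

Lemma adj_mx_sym : (adj_mx R Gam)^T = adj_mx R Gam.
Proof. by apply/matrixP => i j; rewrite !mxE adj_sym setUC. Qed.

Lemma nullityE : nullity R Gam = (n - \rank (adj_mx R Gam))%N.
Proof. exact/mup0_char_poly_sym/adj_mx_sym. Qed.

(* The submatrix on x, z, y, w is nonsingular: y is a pendant vertex with
   neighbour w, and deleting both leaves the edge xz. *)
Lemma rank_adj_mx_ge4 (x y z w : 'I_n) :
  Gam x z -> Gam y w -> ~~ Gam x y -> ~~ Gam z y ->
  (4 <= \rank (adj_mx R Gam))%N.
Proof.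
move=> xz yw xy zy.
pose f : 'I_4 -> 'I_n := tnth [tuple x; z; y; w].
suff /eqP <- : row_free (rowsub f (adj_mx R Gam)) by exact/mxrankS/rowsub_sub.
apply: inj_row_free => u u0.
have sgn (b : bool) : (-1) ^+ b != 0 :> R by rewrite signr_eq0.
(* [E j] is the equation of column [j]. Taken in the order [y], [x], [z], [w], each leaves a single
   unknown with coefficient a sign. *)
have E j : \sum_(i < 4) u 0 i * adj_mx R Gam (f i) j = 0.
  transitivity ((u *m rowsub f (adj_mx R Gam)) 0 j); last by rewrite u0 mxE.
  by rewrite mxE; apply: eq_bigr => i _; rewrite !mxE.
have S4 (F : 'I_4 -> R) : \sum_i F i = F 0 + F 1 + F 2 + F 3.
  rewrite !big_ord_recl big_ord0 addr0 !addrA.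
  by congr (F _ + F _ + F _ + F _); apply: val_inj.
have f0 : f 0 = x by []. have f1 : f 1 = z by [].
have f2 : f 2 = y by []. have f3 : f 3 = w by [].
have u3 : u 0 3 = 0.
  have := E y; rewrite S4 f0 f1 f2 f3 !mxE (negbTE xy) (negbTE zy) adj_irr.
  rewrite (adj_sym Gam w) yw !mulr0 !add0r => /eqP.
  by rewrite mulf_eq0 (negbTE (sgn _)) orbF => /eqP.
have u1 : u 0 1 = 0.
  have := E x; rewrite S4 f0 f1 f2 f3 !mxE u3 (adj_sym Gam y) (negbTE xy).
  rewrite adj_irr (adj_sym Gam z) xz !mulr0 mul0r add0r !addr0 => /eqP.
  by rewrite mulf_eq0 (negbTE (sgn _)) orbF => /eqP.
have u00 : u 0 0 = 0.
  have := E z; rewrite S4 f0 f1 f2 f3 !mxE u3 u1 (adj_sym Gam y) (negbTE zy).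
  rewrite xz !mulr0 !mul0r !addr0 => /eqP.
  by rewrite mulf_eq0 (negbTE (sgn _)) orbF => /eqP.
have u2 : u 0 2 = 0.
  have := E w; rewrite S4 f0 f1 f2 f3 !mxE u3 u1 u00 yw.
  rewrite !mul0r !addr0 add0r => /eqP.
  by rewrite mulf_eq0 (negbTE (sgn _)) orbF => /eqP.
apply/rowP => i; rewrite mxE.
case: i => [[|[|[|[|//]]]] i4];
  [rewrite -u00 | rewrite -u1 | rewrite -u2 | rewrite -u3];
  by congr (u _ _); apply: val_inj.
Qed.

End SignedAdjacency.

(** * Edge counts and the upper bound on the nullity *)

Lemma card_edges_lt (n : nat) (G : sgraph 'I_n) :
  #|edges G| = (\sum_(j < n) #|[set i : 'I_n | (i < j)%N && G i j]|)%N.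
Proof.
(* Increasing pairs represent every edge once, so each edge is charged to its larger end. *)
pose D := [set p : 'I_n * 'I_n | (p.1 < p.2)%N && G p.1 p.2].
pose f (p : 'I_n * 'I_n) := [set p.1; p.2].
have f_inj : {in D &, injective f}.
  move=> [a b] [c d]; rewrite !inE /f /= => /andP[ab _] /andP[cd _] E.
  have: a \in [set c; d] by rewrite -E set21.
  have: b \in [set c; d] by rewrite -E set22.
  rewrite !inE => /orP[]/eqP bE /orP[]/eqP aE; subst=> //; try lia.
have -> : edges G = f @: D.
  apply/setP => e; rewrite inE; apply/existsP/imsetP.
    move=> [x /existsP[y /andP[Gxy /eqP ->]]].
    case: (ltngtP x y) => [xy|yx|/val_inj xy].
    - by exists (x, y); rewrite // inE /= xy.
    - by exists (y, x); rewrite ?inE /= ?yx ?(adj_sym G y) // /f setUC.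
    - by rewrite xy adj_irr in Gxy.
  move=> [[x y]]; rewrite inE /= => /andP[_ Gxy] ->.
  by exists x; apply/existsP; exists y; rewrite Gxy eqxx.
rewrite card_in_imset // -sum1_card.
under [RHS]eq_bigr => j _ do rewrite -sum1_card.
rewrite (exchange_big_dep xpredT) //= pair_big_dep /=.
by apply: eq_bigl => -[i j]; rewrite !inE.
Qed.

(** Each degree splits into smaller and larger neighbours; summed over all vertices, either part
    counts every edge once. *)
Lemma handshake (n : nat) (G : sgraph 'I_n) :
  (\sum_x #|G x| = 2 * #|edges G|)%N.
Proof.
have degE x : #|G x| =
    (#|[set i : 'I_n | (i < x)%N && G i x]| + \sum_(i : 'I_n | (x < i)%N && G x i) 1)%N.
  rewrite -sum1_card (bigID (fun i : 'I_n => i < x)%N) /= -sum1_card.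
  congr (_ + _)%N; apply: eq_bigl => i.
    by rewrite !inE (adj_sym G i) andbC.
  rewrite -leqNgt leq_eqVlt -[i \in G x]/(G x i); case: eqP => [/val_inj ->|_] /=.
    by rewrite adj_irr andbF.
  by rewrite andbC.
under eq_bigr => x _ do rewrite degE.
rewrite big_split /= -card_edges_lt mul2n -addnn; congr (_ + _)%N.
rewrite card_edges_lt; under [RHS]eq_bigr => j _ do rewrite -sum1_card.
rewrite [RHS](exchange_big_dep xpredT) //=.
by apply: eq_bigr => i _; apply: eq_bigl => j; rewrite !inE.
Qed.

Lemma connected_has_neighbour (n : nat) (G : sgraph 'I_n) (y : 'I_n) :
  (1 < n)%N -> connected_on G [set: 'I_n] -> exists w, G y w.
Proof.
move=> n_gt1 connG.
have [x xy] : exists x, x != y.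
  have : (0 < #|predC1 y|)%N by rewrite cardC1 card_ord; lia.
  by case/card_gt0P => x; exists x.
case/connectP: (connG y x (in_setT _) (in_setT _)) => -[|w p] /=.
  by move=> _ E; rewrite E eqxx in xy.
by case/andP => /and3P[_ _ yw] _ _; exists w.
Qed.

(* If non-adjacency were transitive, G would be complete multipartite; a class
   of size c then meets c (n - c) edges, which exceeds n + 1 unless c is 1 or
   n - 1, i.e. unless G is complete or a star. *)
Lemma bicyclic_nonadj_not_transitive (n : nat) (G : sgraph 'I_n) :
  (6 <= n)%N -> bicyclic G ->
  exists x y z, [/\ ~~ G x y, ~~ G y z & G x z].
Proof.
move=> n_ge6 [connG edgesG].
case: (boolP [exists x, exists y, exists z, [&& ~~ G x y, ~~ G y z & G x z]]).
  by case/existsP=> x /existsP[y /existsP[z /and3P[]]]; exists x, y, z.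
move=> noG; exfalso.
have Gtr x y z : ~~ G x y -> ~~ G y z -> ~~ G x z.
  move=> xy yz; apply: contra noG => xz.
  by apply/existsP; exists x; apply/existsP; exists y; apply/existsP; exists z;
    rewrite xy yz.
have sum_deg : (\sum_x #|G x| = 2 * n.+1)%N.
  by rewrite handshake edgesG card_ord.
pose c v := #|[predC G v]|.
have degE v : (#|G v| + c v = n)%N by rewrite cardC card_ord.
have c_gt0 v : (0 < c v)%N.
  by apply/card_gt0P; exists v; rewrite inE /= -[v \in G v]/(G v v) adj_irr.
have deg_gt0 v : (0 < #|G v|)%N.
  have [|w vw] := @connected_has_neighbour n G v _ connG; first lia.
  by apply/card_gt0P; exists w.
have deg_class v u : ~~ G v u -> #|G u| = #|G v|.
  move=> vu; have uv : ~~ G u v by rewrite adj_sym.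
  apply: eq_card => w; apply: negb_inj.
  by apply/idP/idP; apply: Gtr.
have split_deg v :
    (\sum_x #|G x| = c v * #|G v| + \sum_(w in G v) #|G w|)%N.
  rewrite (bigID (mem (G v))) /= addnC; congr (_ + _)%N.
  rewrite -sum_nat_const; apply: eq_big => [w|w vw]; first by rewrite !inE.
  exact: deg_class.
(* Each neighbour of [v] is joined to the whole class of [v], so with [d] the degree,
   [2 * c * d <= 2 * (n + 1)]. If [c] and [d] were both at least 2, then
   [c * d >= 2 * (n - 2) > n + 1], as [n >= 6]. *)
have c_small v : c v = 1%N \/ #|G v| = 1%N.
  have le_sum : (#|G v| * c v <= \sum_(w in G v) #|G w|)%N.
    rewrite -sum_nat_const; apply: leq_sum => w vw.
    apply/subset_leq_card/subsetP => u; rewrite !inE => vu.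
    apply/negPn/negP => wu; have := Gtr v u w vu.
    by rewrite (adj_sym G u) wu => /(_ isT); rewrite [G v w]vw.
  have := split_deg v; have := degE v; have := c_gt0 v; have := deg_gt0 v.
  rewrite sum_deg; move: le_sum; set S := (\sum_(_ in _) _)%N; nia.
(* A vertex of degree 1 bounds the degree sum by [2 * (n - 1)]; with no such vertex all degrees are
   [n - 1] and the sum is [n * (n - 1)]. Neither agrees with [2 * (n + 1)]. *)
case: (boolP [exists v, #|G v| == 1%N]) => [/existsP[v /eqP deg1]|].
  have : (\sum_(w in G v) #|G w| <= \sum_(w in G v) n.-1)%N.
    by apply: leq_sum => w _; have := degE w; have := c_gt0 w; lia.
  have := split_deg v; have := degE v.
  rewrite sum_nat_const sum_deg deg1; lia.
rewrite negb_exists => /forallP deg_neq1.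
have : (\sum_(x < n) #|G x| = \sum_(x < n) n.-1)%N.
  apply: eq_bigr => x _; have := degE x.
  by case: (c_small x) => [|/eqP/(negP (deg_neq1 x))//]; lia.
by rewrite sum_nat_const sum_deg card_ord; nia.
Qed.

Lemma nullity_bicyclic_le (R : rcfType) (n : nat) (Gam : signed_graph 'I_n) :
  (6 <= n)%N -> bicyclic Gam -> (nullity R Gam <= n - 4)%N.
Proof.
move=> n_ge6 bicG; rewrite nullityE leq_sub2l //.
have [x [y [z [xy yz xz]]]] := bicyclic_nonadj_not_transitive n_ge6 bicG.
have [|w yw] := connected_has_neighbour y _ bicG.1; first lia.
by apply: rank_adj_mx_ge4 xz yw xy _; rewrite adj_sym.
Qed.

(** * Connectedness and trees from a parent of smaller index *)

Lemma connected_of_parent (n : nat) (G : sgraph 'I_n) (S : {set 'I_n})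
    (root : 'I_n) :
    (forall x, x \in S -> x != root ->
       exists y : 'I_n, [/\ y \in S, (y < x)%N & G x y]) ->
  connected_on G S.
Proof.
move=> parent; pose e := [rel a b | [&& a \in S, b \in S & G a b]].
have e_sym : symmetric e by move=> a b /=; rewrite (adj_sym G a) andbCA.
have to_root k (x : 'I_n) : (x < k)%N -> x \in S -> connect e x root.
  elim: k x => // k IH x xk xS.
  have [->|xr] := eqVneq x root; first exact: connect0.
  have [y [yS yx Gxy]] := parent x xS xr.
  apply: connect_trans (IH y _ yS); last by apply: leq_trans yx _.
  by apply: connect1; rewrite /= xS yS.
move=> x y xS yS; apply: connect_trans (to_root _ x (ltnSn x) xS) _.
by rewrite (sym_connect_sym e_sym); apply: to_root (ltnSn y) yS.
Qed.

(** The largest vertex of a cycle would have two distinct smaller neighbours, its two neighbours on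
    the cycle. *)
Lemma tree_of_parent (n : nat) (G : sgraph 'I_n) (S : {set 'I_n}) (root : 'I_n) :
    root \in S ->
    (forall x, x \in S -> x != root ->
       exists y : 'I_n, [/\ y \in S, (y < x)%N & G x y]) ->
    (forall x y z : 'I_n, x \in S -> y \in S -> z \in S ->
       (y < x)%N -> (z < x)%N -> G x y -> G x z -> y = z) ->
  is_tree_on G S.
Proof.
move=> rootS parent parent_uniq; split.
- by apply/set0Pn; exists root.
- exact: connected_of_parent parent.
- move=> c cS [c_gt2 /andP[cycG uniqc]].
  have [x0 x0c] : exists x0, x0 \in c.
    by case: c c_gt2 {cS cycG uniqc} => // x0 c _; exists x0; rewrite mem_head.
  case: (@arg_maxnP _ x0 (mem c) val x0c) => x xc x_max.
  have [i p rot_c] := rot_to xc.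
  move: cycG uniqc c_gt2; rewrite -(rot_cycle i) -(rot_uniq i) -(size_rot i) rot_c.
  case: p rot_c => [|y [|z p]] //= rot_c /andP[Gxy].
  rewrite rcons_path => /andP[_ /andP[_ Gtx]] uniq_p _.
  set t := last z p in Gtx.
  have tzp : t \in z :: p by exact: mem_last.
  have in_c w : w \in [:: x, y, z & p] -> w \in c by rewrite -rot_c mem_rot.
  have yc : y \in c by apply: in_c; rewrite !inE eqxx orbT.
  have tc : t \in c by apply: in_c; rewrite 2!in_cons tzp !orbT.
  move: uniq_p => /andP[xyp /andP[yzp _]].
  have lt_x w : w \in c -> w \in y :: z :: p -> (w < x)%N.
    move=> /x_max wx wp; rewrite ltn_neqAle [(_ <= _)%N]wx andbT.
    by apply: contraNneq xyp => /val_inj <-.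
  have yt : y = t.
    apply: (parent_uniq x); rewrite ?(cS _ _) // 1?adj_sym //.
      by apply: lt_x; rewrite ?mem_head.
    by apply: lt_x; rewrite // in_cons tzp orbT.
  by rewrite yt tzp in yzp.
Qed.

(** * The broom with two chords: an unbalanced member of [Theta_n] *)

Lemma sum_eqn_ord (n k : nat) (b : bool) :
  (\sum_(i < n) (b && (i == k :> nat)) = b && (k < n))%N.
Proof.
rewrite -(big_mkord xpredT (fun i => (b && (i == k) : nat))).
elim: n => [|n IHn]; first by rewrite big_geq ?andbF.
by rewrite big_nat_recr //= IHn; lia.
Qed.

(* Each j > 0 is joined to min (j-1, m-2): this is the path 0 - 1 - ... - (m-2)
   with leaves at m-2. *)
Definition broom_arc (m i j : nat) : bool :=
  ((i < j) && [|| i == minn j.-1 (m - 2), (i == 0) && (j == 2)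
                | (i == 1) && (j == 3)])%N.

Definition broom_rel (m n : nat) : rel 'I_n :=
  fun i j => broom_arc m i j || broom_arc m j i.

Lemma broom_rel_sym (m n : nat) : symmetric (@broom_rel m n).
Proof. by move=> i j; rewrite /broom_rel orbC. Qed.

Lemma broom_rel_irr (m n : nat) : irreflexive (@broom_rel m n).
Proof. by move=> i; rewrite /broom_rel /broom_arc ltnn. Qed.

(** The only edge inside [{0, 2}] is the chord 02, hence the only negative one. *)
Definition broom (m n : nat) : signed_graph 'I_n :=
  @SignedGraph _ (SGraph (@broom_rel_sym m n) (@broom_rel_irr m n))
    (fun e => e \subset [set i : 'I_n | (i == 0 :> nat) || (i == 2 :> nat)]).

Section Broom.
Variables (m n : nat).
Hypotheses (m_ge4 : (4 <= m)%N) (mn : (m <= n)%N).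

Let G := broom m n.

Lemma broom_connected : connected_on G [set: 'I_n].
Proof.
have n_gt0 : (0 < n)%N by lia.
apply: (@connected_of_parent _ _ _ (Ordinal n_gt0)) => x _.
rewrite -val_eqE /= => x0; have xn := ltn_ord x.
have yn : (minn x.-1 (m - 2) < n)%N by lia.
exists (Ordinal yn); rewrite in_setT /G /= /broom_rel /broom_arc /=.
by split=> //; lia.
Qed.

Lemma card_edges_broom : #|edges G| = n.+1.
Proof.
(* The smaller neighbours of [j] are its parent if [j > 0], and the other end of a chord if [j] is 2
   or 3. *)
have degE (j : 'I_n) : #|[set i : 'I_n | (i < j)%N && G i j]| =
    ((0 < j) + (j == 2 :> nat) + (j == 3 :> nat))%N.
  have jn := ltn_ord j.
  rewrite -sum1_card big_mkcond /=.
  transitivity (\sum_(i < n) (((0 < j) && (i == minn j.-1 (m - 2) :> nat))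
    + ((j == 2 :> nat) && (i == 0 :> nat))
    + ((j == 3 :> nat) && (i == 1 :> nat))))%N.
    apply: eq_bigr => i _; rewrite !inE /G /= /broom_rel /broom_arc.
    have [] : [/\ 0 < j -> minn j.-1 (m - 2) < j, j = 2 :> nat -> minn j.-1 (m - 2) = 1
      & j = 3 :> nat -> minn j.-1 (m - 2) = 2]%N by split; lia.
    move: (minn _ _) => q qj q2 q3.
    rewrite (_ : forall P Q, (i < j) && ((i < j) && P || (j < i) && Q) =
      (i < j) && P)%N; last by move=> P Q; case: (ltngtP i j); rewrite ?orbF.
    case: (posnP j) => [->|j0] //=.
    have {qj} qj := qj j0.
    case: (eqVneq (j : nat) 2%N) q2 => [j2 /(_ j2) q1|j2 _].
      by rewrite j2 q1 in q3 qj *; clear; case: (nat_of_ord i) => [|[|[|?]]].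
    case: (eqVneq (j : nat) 3%N) q3 => [j3 /(_ j3) q2|j3 _].
      by rewrite j3 q2 in qj *; clear; case: (nat_of_ord i) => [|[|[|[|?]]]].
    rewrite !andbF !orbF /= !addn0.
    by case: eqVneq => [->|]; rewrite ?qj ?andbF.
  by rewrite !big_split /= !sum_eqn_ord; lia.
rewrite card_edges_lt; under eq_bigr => j _ do rewrite degE.
(* Adding the indicator of [j = 0] to both sides turns [0 < j] into the constant 1. *)
apply/eqP; rewrite -(eqn_add2r (\sum_(j < n) ((j == 0 :> nat)))) -big_split /=.
rewrite (eq_bigr (fun j : 'I_n => 1 + (j == 2 :> nat) + (j == 3 :> nat)))%N.
  by rewrite !big_split /= !(sum_eqn_ord _ _ true) sum_nat_const card_ord; lia.
by move=> j _; lia.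
Qed.

Lemma broom_attached : attached_trees G [set i : 'I_n | (i < 4)%N].
Proof.
(* Everything outside the theta hangs off vertex 3 when [m >= 5], and off vertex 2 when [m = 4]. *)
have rn : (minn 3 (m - 2) < n)%N by lia.
pose r (x : 'I_n) : 'I_n := if (x < 4)%N then x else Ordinal rn.
have rE x : r x = (if x < 4 then x : nat else minn 3 (m - 2))%N :> nat.
  by rewrite /r; case: ifP.
exists r; split.
- by move=> x; rewrite inE rE; case: ifP => //; lia.
- by move=> s; rewrite inE /r => ->.
- move=> s; rewrite inE => s4.
  apply: (@tree_of_parent _ _ _ s).
  + by rewrite inE /r s4.
  + move=> x; rewrite inE -!val_eqE /= rE => xs xNs; have xn := ltn_ord x.
    have yn : (minn x.-1 (m - 2) < n)%N by lia.
    exists (Ordinal yn); rewrite inE -val_eqE /= rE /broom_rel /broom_arc /=.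
    by move: xs; case: ifP => x4 xs; split; try case: ifP; lia.
  + move=> x y z; rewrite !inE -!val_eqE /= !rE /broom_rel /broom_arc.
    move=> xs ys zs yx zx xy xz; apply: val_inj => /=.
    by move: xs ys zs; do 3 case: ifP; lia.
- move=> x y; rewrite /= /broom_rel /broom_arc => xy.
  case: (boolP ((x < 4) && (y < 4))%N) => [/andP[x4 y4]|xy4].
    by right; rewrite !inE.
  by left; apply: val_inj; rewrite /= !rE; do 2 case: ifP; lia.
Qed.

Lemma broom_theta : is_theta_on 1 2 2 G [set i : 'I_n | (i < 4)%N].
Proof.
have n0 : (0 < n)%N by lia.
have n1 : (1 < n)%N by lia.
have n2 : (2 < n)%N by lia.
have n3 : (3 < n)%N by lia.
have mem4 (x : 'I_n) : (x < 4)%N =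
    (x \in [:: Ordinal n1; Ordinal n2; Ordinal n0; Ordinal n3]).
  by rewrite !inE -!val_eqE /=; lia.
(* The common ends are 1 and 2, joined by their edge and by paths through 0 and through 3. *)
exists (Ordinal n1), (Ordinal n2), [::], [:: Ordinal n0], [:: Ordinal n3].
split=> //.
- by move=> x; rewrite inE mem4.
- move=> e; rewrite inE /= /path_edges /=; apply/idP/idP.
    rewrite inE => /andP[/existsP[x /existsP[y /andP[Gxy /eqP->]]]].
    rewrite subUset !sub1set !inE !mem4 => /andP[].
    rewrite !inE => /or4P[]/eqP xE /or4P[]/eqP yE;
      move: Gxy; rewrite xE yE /= /broom_rel /broom_arc /= => Gxy;
      first [by exfalso; lia
            | by rewrite !eqxx ?orbT
            | by rewrite (setUC [set _] [set _]) !eqxx ?orbT].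
  have edge (x y : 'I_n) : (x < 4)%N -> (y < 4)%N -> G x y ->
      ([set x; y] \in edges G) && ([set x; y] \subset [set i : 'I_n | (i < 4)%N]).
    move=> x4 y4 Gxy; rewrite subUset !sub1set !inE x4 y4 !andbT.
    by apply/existsP; exists x; apply/existsP; exists y; rewrite Gxy eqxx.
  move=> e_path; rewrite !inE in e_path.
  case/or4P: e_path => [|||/orP[]] /eqP->;
    by apply: edge; rewrite //= /broom_rel /broom_arc /=; lia.
Qed.

Lemma broom_in_Theta : in_Theta G.
Proof.
split; first by split; [exact: broom_connected | rewrite card_edges_broom card_ord].
exists 1%N, 2%N, 2%N, [set i : 'I_n | (i < 4)%N]; split=> //.
  exact: broom_theta.
exact: broom_attached.
Qed.

Lemma broom_unbalanced : unbalanced G.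
Proof.
have n0 : (0 < n)%N by lia.
have n1 : (1 < n)%N by lia.
have n2 : (2 < n)%N by lia.
(* In the triangle 0, 1, 2 only the edge 02 is negative. *)
pose c := [:: Ordinal n0; Ordinal n1; Ordinal n2].
have cycle_c : is_cycle G c.
  by split=> //; apply/andP; split=> //=; rewrite /broom_rel /broom_arc /=; lia.
move=> /(_ c cycle_c).
by rewrite /positive_cycle /= !subUset !sub1set !inE.
Qed.

End Broom.

(** * Rank of the broom *)

Section BroomRank.
Variables (R : rcfType) (m n : nat).
Hypotheses (m_ge4 : (4 <= m)%N) (mn : (m <= n)%N).

Let A := adj_mx R (broom m n).

Lemma adj_mx_broom (i j : 'I_n) : A i j =
  if broom_arc m i j || broom_arc m j i then
    (-1) ^+ (((i == 0 :> nat) || (i == 2 :> nat)) &&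
             ((j == 0 :> nat) || (j == 2 :> nat)))
  else 0.
Proof. by rewrite mxE /= subUset !sub1set !inE. Qed.

Lemma broom_arcE (i j : nat) : (i < m)%N -> (j < m)%N ->
  broom_arc m i j =
  [|| i.+1 == j, (i == 0) && (j == 2) | (i == 1) && (j == 3)]%N.
Proof.
move=> im jm; rewrite /broom_arc.
case: j jm => [|j] jm; first by rewrite !andbF.
have -> : minn j.+1.-1 (m - 2) = j by lia.
by lia.
Qed.

(** A sum of indicators lets each column equation of the kernel split term by term. *)
Lemma adj_mx_broom_lt (i j : 'I_n) : (i < m)%N -> (j < m)%N ->
  A i j = (i.+1 == j)%:R + (i == j.+1 :> nat)%:R
    - ((i == 0 :> nat) && (j == 2 :> nat))%:R
    - ((i == 2 :> nat) && (j == 0 :> nat))%:R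
    + ((i == 1 :> nat) && (j == 3 :> nat))%:R
    + ((i == 3 :> nat) && (j == 1 :> nat))%:R.
Proof.
move=> im jm; rewrite adj_mx_broom !broom_arcE //.
case: (nat_of_ord i) (nat_of_ord j) => [|[|[|[|i']]]] [|[|[|[|j']]]] //=;
  rewrite ?eqSS ?andbF ?andbT ?orbF ?expr0 ?expr1 ?subr0 ?addr0 ?add0r //.
- by case: eqP.
- by rewrite eq_sym; case: eqP.
rewrite (eq_sym j'.+1); case: eqP => [<-|_] /=; last by rewrite add0r; case: eqP.
by rewrite (ltn_eqF (leqnSn i'.+1)) addr0.
Qed.

(* The kernel equations give x = (0, p, p, -p, -2p, p, 2p, -p, ...), and the
   equation of the last column forces the next term of this sequence to be 0. *)
Lemma row_free_broom : row_free (rowsub (widen_ord mn) A).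
Proof.
apply: inj_row_free => u u0.
(* Extending [u] by zero makes the equation of column [m - 1] uniform with the others, its next term
   being [f m = 0]. *)
pose f (i : nat) : R := if insub i is Some o then u 0 o else 0.
have fE (i : 'I_m) : f i = u 0 i by rewrite /f valK.
have f_ge (i : nat) : (m <= i)%N -> f i = 0.
  by move=> mi; rewrite /f insubF // ltnNge mi.
have sum_delta (k : nat) (b : bool) :
    \sum_(i < m) f i * ((i == k :> nat) && b)%:R = f k * b%:R.
  case: (ltnP k m) => [km|mk].
    rewrite (bigD1 (Ordinal km)) //= eqxx big1 ?addr0 // => i.
    by rewrite -val_eqE /= => /negbTE->; rewrite mulr0.
  rewrite f_ge // mul0r big1 // => i _.
  by rewrite (ltn_eqF (leq_trans (ltn_ord i) mk)) mulr0.
have col_eq (j : nat) : (j < m)%N ->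
    (if j is j'.+1 then f j' else 0) + f j.+1 - f 0%N * (j == 2)%:R
      - f 2%N * (j == 0)%:R + f 1%N * (j == 3)%:R + f 3%N * (j == 1)%:R = 0.
  move=> jm; have jn : (j < n)%N by lia.
  transitivity ((u *m rowsub (widen_ord mn) A) 0 (Ordinal jn)).
    2: by rewrite u0 mxE.
  rewrite mxE -!sum_delta.
  have -> : (if j is j'.+1 then f j' else 0) = \sum_(i < m) f i * (i.+1 == j)%:R.
    case: j {jm jn} => [|j].
      by rewrite big1 // => i _; rewrite mulr0.
    by rewrite -[LHS](mulr1 _) -(sum_delta j true); apply: eq_bigr => i _; rewrite andbT.
  have -> : f j.+1 = \sum_(i < m) f i * (i == j.+1 :> nat)%:R.
    by rewrite -[LHS](mulr1 _) -(sum_delta _ true); apply: eq_bigr => i _; rewrite andbT.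
  rewrite -!sumrN -!big_split /=; apply: eq_bigr => i _.
  rewrite -fE mxE adj_mx_broom_lt //=; ring.
have eq0 := col_eq 0%N; have eq1 := col_eq 1%N; have eq2 := col_eq 2%N.
have eq3 := col_eq 3%N; rewrite /= !mulr0 !mulr1 in eq0 eq1 eq2 eq3.
have {}eq0 := eq0 ltac:(lia); have {}eq1 := eq1 ltac:(lia).
have {}eq2 := eq2 ltac:(lia); have {}eq3 := eq3 ltac:(lia).
(* Columns from 4 on meet no chord, which leaves a two-step recurrence. *)
have step (j : nat) : (3 <= j)%N -> (j.+2 <= m)%N -> f j.+2 = - f j.
  case: j => [|[|[|j]]] // _ jm.
  by have := col_eq j.+4 jm; rewrite /= !mulr0; lra.
have p0 : f 1%N = 0.
  (* The recurrence carries a zero of [f] back to [f 3 = - f 1] or [f 4 = - 2 * f 1]; pairing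
     consecutive indices covers both parities. *)
  have pj k : ((k.+3 <= m)%N -> f k.+3 = 0 -> f 1%N = 0) /\
              ((k.+4 <= m)%N -> f k.+4 = 0 -> f 1%N = 0).
    elim: k => [|k [IH1 IH2]]; first by split=> _ f0; lra.
    split=> // km; rewrite step // => /eqP; rewrite oppr_eq0 => /eqP.
    by apply: IH1; lia.
  have [+ _] := pj (m - 3)%N.
  have -> : (m - 3).+3 = m by lia.
  by apply; rewrite ?f_ge.
have fj k : ((k.+3 <= m)%N -> f k.+3 = 0) /\ ((k.+4 <= m)%N -> f k.+4 = 0).
  elim: k => [|k [IH1 IH2]]; first by split=> _; lra.
  split=> // km; rewrite step // IH1 ?oppr0 //; lia.
apply/rowP => i; rewrite mxE -fE; have := ltn_ord i.
case: (nat_of_ord i) => [|[|[|k km]]]; [lra|lra|lra|].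
by apply: (fj k).1; lia.
Qed.

(* A leaf row equals row m-1, or (row 3 - row 0) / 2 when m = 4. *)
Lemma adj_mx_broom_sub : (A <= rowsub (widen_ord mn) A)%MS.
Proof.
set B := rowsub _ A.
have in_B (i : 'I_n) : (i < m)%N -> (row i A <= B)%MS.
  move=> im; have <- : row (Ordinal im) B = row i A.
    by rewrite row_rowsub; congr row; apply: val_inj.
  exact: row_sub.
apply/row_subP => i; case: (ltnP i m) => [|mi]; first exact: in_B.
have i_n := ltn_ord i.
(* Vertex [m - 1] is itself a leaf when [m >= 5]. For [m = 4] it is vertex 3, an end of the chord
   13, and [4 <= l] excludes it. *)
have leaf (l j : 'I_n) : (m.-1 <= l)%N -> (4 <= l)%N ->
    A l j = (j == m - 2 :> nat)%N%:R.
  move=> ml l4; rewrite adj_mx_broom.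
  have -> : broom_arc m l j || broom_arc m j l = (j == m - 2 :> nat)%N.
    by rewrite /broom_arc; lia.
  rewrite (_ : (l == 0 :> nat)%N || (l == 2 :> nat)%N = false) /=; last by lia.
  by case: eqP.
have rowE (l j : 'I_n) : row l A 0 j = A l j by rewrite mxE.
have [m4|m_neq4] := eqVneq m 4%N; last first.
  have ln : (m.-1 < n)%N by lia.
  suff -> : row i A = row (Ordinal ln) A by apply: in_B => /=; lia.
  by apply/rowP => j; rewrite !rowE !leaf //=; lia.
have n0 : (0 < n)%N by lia.
have n3 : (3 < n)%N by lia.
suff -> : row i A = 2^-1 *: (row (Ordinal n3) A - row (Ordinal n0) A).
  by rewrite scalemx_sub // addmx_sub ?eqmx_opp ?in_B //= m4.
have half (v w : 'rV[R]_n) j : (2^-1 *: (v - w)) 0 j = 2^-1 * (v 0 j - w 0 j).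
  by rewrite !mxE.
apply/rowP => j; rewrite half !rowE leaf; try lia.
rewrite !adj_mx_broom m4 /= /broom_arc.
case: (nat_of_ord j) => [|[|[|[|k]]]] //=;
  rewrite ?expr0 ?expr1; lra.
Qed.

Lemma rank_broom : \rank A = m.
Proof.
have /eqP rkB := row_free_broom; apply/eqP; rewrite -[X in _ == X]rkB.
by rewrite eqn_leq !mxrankS ?rowsub_sub ?adj_mx_broom_sub.
Qed.

End BroomRank.

Unset Implicit Arguments.

Theorem theorem5p7 (R : rcfType) (n : nat) (hn : (6 <= n)%N) :
  forall k : nat,
    (exists Gam : signed_graph 'I_n,
        [/\ in_Theta Gam, unbalanced Gam & nullity R Gam = k])
    <-> (k <= n - 4)%N.
Proof.
move=> k; split=> [[Gam [[bicG _] _ <-]]|k_le].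
  exact: nullity_bicyclic_le.
(* Nullity [k] asks for rank [n - k], which lies between 4 and [n]. *)
have m_ge4 : (4 <= n - k)%N by lia.
have mn : (n - k <= n)%N by lia.
exists (broom (n - k) n); split.
- exact: broom_in_Theta.
- exact: broom_unbalanced.
- by rewrite nullityE rank_broom // subKn //; lia.
Qed.
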